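(* For each integer $q$ there exists a subset $\mathscr{N}_q\subset\{2,3,\dots,q-1\}$ such that, as $q\to\infty$, $$\#\mathscr{N}_q=q+O\!\left(\frac{q}{\log_2 q}\right),$$ where the implied constant is less than $1$, and, provided $k=k(q)$ is a positive integer satisfying $k=o(\sqrt{\log_2 q})$, $$\#\{\mathscr{S}\in\mathscr{N}_q^{[k]}:\ \mathscr{S}\text{ is multiplicatively independent}\}=\binom{\#\mathscr{N}_q}{k}+O\big((\#\mathscr{N}_q)^{k-3/2+o(1)}\big)=\frac{q^k}{k!}+O\!\left(\frac{q^k}{(k-1)!\,\log_2 q}\right).$$
   Context: For a set $\mathscr{A}$ and $k\in\mathbb{N}$, $\mathscr{A}^{[k]}$ denotes the set of $k$-element subsets of $\mathscr{A}$. Positive integers $n_1,\dots,n_r$ are multiplicatively independent if $\alpha_1=\dots=\alpha_r=0$ is the only integer solution of $n_1^{\alpha_1}\cdots n_r^{\alpha_r}=1$; a set is multiplicatively independent if its elements are. $\log x:=\max\{\ln x,2\}$ and $\log_2 x=\log\log x$. *)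

(* Defs.v *)
From HB Require Import structures.
From mathcomp Require Import all_boot all_order all_algebra.
From mathcomp Require Import all_classical all_reals all_analysis.
Set Implicit Arguments. Unset Strict Implicit. Unset Printing Implicit Defensive.
Import Order.TTheory GRing.Theory Num.Theory.
Local Open Scope ring_scope.

(* The paper's convention: log x := max{ln x, 2}. *)
Definition logm (R : realType) (x : R) : R := Num.max (ln x) 2.
Definition log2 (R : realType) (x : R) : R := logm (logm x).

Definition mult_indep (q : nat) (S : {set 'I_q}) : Prop :=
  forall a : 'I_q -> int,
    \prod_(i in S) (((val i)%:R : rat) ^ (a i)) = 1 ->
    forall i, i \in S -> a i = 0.

Definition count_indep (q : nat) (N : {set 'I_q}) (k : nat) : nat :=
  #|[set S : {set 'I_q} | (S \subset N) && (#|S| == k) && `[< mult_indep S >]]|.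

(* Main.v *)
Require Import Defs.
From HB Require Import structures.
From mathcomp Require Import all_boot all_order all_algebra.
From mathcomp Require Import all_classical all_reals all_analysis.
From mathcomp Require Import zify ring lra.
Import Order.TTheory GRing.Theory Num.Theory numFieldNormedType.Exports.

(* N_q consists of the integers 1 < n < q with at most 2 l prime factors, where
   2 ^ l is about the binary length L of q, so that l is about log log q.  As
   2 ^ omega(n) <= tau(n) and the sum of tau(n) over n < q is at most q L, at most
   q / (2 L) integers have more prime factors than that.

   In a dependent set S, let A be the support of a nontrivial multiplicative
   relation, r := #|A|, and m the product of the primes dividing the members of A.
   Comparing p-adic valuations, every such prime divides two members of A, so
   m ^ 2 <= q ^ r; if r = 2 both members are powers of a common base and even
   m ^ 2 <= q.  In either case m <= q ^ (r - 3/2).  Given m, which has at most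
   2 l r prime factors, each member of A is determined by at most 2 l r exponents
   below L.  So there are at most q ^ (r - 3/2) * L ^ (2 l r ^ 2)
   possible A, hence roughly q ^ (k - 3/2) * L ^ (2 l k ^ 2) dependent k-sets, and
   k ^ 2 <= l makes the last factor 2 ^ O(l ^ 3) = q ^ o(1). *)

(** * Elementary counting inequalities *)

Lemma leq_card_bigcup (I T : finType) (P : pred I) (F : I -> {set T}) :
  #|\bigcup_(i | P i) F i| <= \sum_(i | P i) #|F i|.
Proof.
elim/big_rec2: _ => [|i m A _ le_Am]; first by rewrite cards0.
by rewrite (leq_trans (leq_card_setU _ _)) ?leq_add2l.
Qed.

Lemma ffact_leq_expn n m : n ^_ m <= n ^ m.
Proof.
elim: m => // m IHm; rewrite ffactnSr expnSr.
by rewrite leq_mul ?leq_subr.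
Qed.

Lemma bin_leq_expn n m : 'C(n, m) <= n ^ m.
Proof.
by rewrite (leq_trans _ (ffact_leq_expn n m)) // -bin_ffact leq_pmulr ?fact_gt0.
Qed.

Lemma ffact_geq_expn n m : (n - m) ^ m <= n ^_ m.
Proof.
have gen j : j <= m -> (n - m) ^ j <= n ^_ j.
  elim: j => // j IHj ltjm; rewrite ffactnSr expnSr.
  by apply: leq_mul; [apply: IHj; apply: ltnW | rewrite leq_sub2l // ltnW].
exact: gen.
Qed.

(** * Squarefree kernels and smooth numbers *)

Lemma prime_dvd_prod_mem (s : seq nat) p :
  prime p -> all prime s -> (p %| \prod_(r <- s) r) = (p \in s).
Proof.
move=> p_pr; elim: s => [|r s IHs] /=.
  by rewrite big_nil dvdn1 in_nil; case: eqP p_pr => // ->.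
case/andP=> r_pr s_pr; rewrite big_cons Euclid_dvdM // in_cons IHs //.
by rewrite dvdn_prime2.
Qed.

Lemma prod_sqr_dvdn (s : seq nat) m :
    uniq s -> all prime s -> {in s, forall p, p ^ 2 %| m} ->
  (\prod_(p <- s) p) ^ 2 %| m.
Proof.
elim: s => [|p s IHs] /=; first by rewrite big_nil exp1n.
case/andP=> ps s_uniq /andP[p_pr s_pr] sm.
rewrite big_cons expnMn Gauss_dvd; last first.
  by rewrite coprimeXl ?coprimeXr // prime_coprime // prime_dvd_prod_mem.
rewrite sm ?mem_head //=; apply: IHs => // r rs.
by apply: sm; rewrite in_cons rs orbT.
Qed.

Lemma size_primes_prod (s : seq nat) :
  all prime s -> size (primes (\prod_(p <- s) p)) <= size s.
Proof.
move=> s_pr; apply: uniq_leq_size (primes_uniq _) _ => p.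
by rewrite mem_primes => /and3P[p_pr _]; rewrite prime_dvd_prod_mem.
Qed.

(** Adjoining to a product m of distinct primes a new prime p at least doubles the divisors: each d
    yields d and p * d. The radical of n divides n, so its divisors are among those of n. *)
Lemma exp2_size_primes n : 0 < n -> 2 ^ size (primes n) <= size (divisors n).
Proof.
move=> n_gt0.
have gen (s : seq nat) : uniq s -> all prime s ->
    2 ^ size s <= size (divisors (\prod_(p <- s) p)).
  elim: s => [|p s IHs] /=; first by rewrite big_nil.
  case/andP=> ps s_uniq /andP[p_pr s_pr]; rewrite big_cons.
  set m := \prod_(r <- s) r.
  have m_gt0 : 0 < m.
    by rewrite /m big_seq_cond prodn_cond_gt0 // => r /andP[/(allP s_pr)/prime_gt0].
  have p_gt0 := prime_gt0 p_pr.
  have npm : ~~ (p %| m) by rewrite prime_dvd_prod_mem.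
  apply: (@leq_trans (size (divisors m ++ map (muln p) (divisors m)))).
    by rewrite size_cat size_map addnn -mul2n expnS leq_mul2l IHs.
  apply: uniq_leq_size.
    rewrite cat_uniq divisors_uniq map_inj_uniq ?divisors_uniq ?andbT //=.
      apply/hasPn => _ /mapP[d _ ->]; rewrite -dvdn_divisors //.
      by apply: contra npm; apply: dvdn_trans; apply: dvdn_mulr.
    by move=> x y /eqP; rewrite eqn_pmul2l // => /eqP.
  move=> d; rewrite mem_cat -!dvdn_divisors ?muln_gt0 ?p_gt0 //.
  case/orP=> [dm|/mapP[e]]; first by rewrite dvdn_mull.
  by rewrite -dvdn_divisors // => em ->; rewrite dvdn_pmul2l.
have pr_n : all prime (primes n).
  by apply/allP => p; rewrite mem_primes => /and3P[].
apply: leq_trans (gen _ (primes_uniq n) pr_n) _.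
have rad_n : \prod_(p <- primes n) p %| n.
  rewrite {2}(prod_prime_decomp n_gt0) prime_decompE big_map /=.
  rewrite big_seq [X in _ %| X]big_seq.
  apply: (big_ind2 (fun x y => x %| y)) => // [a b c d|p]; first exact: dvdn_mul.
  by rewrite -logn_gt0; case: (logn p n) => // e _; rewrite expnS dvdn_mulr.
apply: uniq_leq_size (divisors_uniq _) _ => d.
rewrite -!dvdn_divisors //; last exact: dvdn_gt0 rad_n.
by move=> dr; apply: dvdn_trans rad_n.
Qed.

Definition bitlen (q : nat) : nat := (trunc_log 2 q).+1.

Lemma ltn_bitlen q : q < 2 ^ bitlen q.
Proof. exact: trunc_log_ltn. Qed.

Lemma bitlen_leq q : 0 < q -> 2 ^ (bitlen q).-1 <= q.
Proof. exact: trunc_logP. Qed.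

Lemma logn_lt_bitlen p n q : n <= q -> logn p n < bitlen q.
Proof.
move=> le_nq; have [->|n_gt0] := posnP n; first by rewrite logn0.
have [p_pr|np_pr] := boolP (prime p); last by rewrite lognE (negbTE np_pr).
rewrite ltnS; apply: trunc_log_max => //; apply: leq_trans le_nq.
apply: leq_trans (dvdn_leq n_gt0 (pfactor_dvdnn p n)).
by case: (logn p n) => // e; rewrite leq_exp2r ?prime_gt1.
Qed.

(** Zero has to be excluded by hand, because [primes 0] is empty. *)
Definition smooth (q m : nat) : {set 'I_q} :=
  [set n : 'I_q | (0 < n) && all (fun p => p %| m) (primes n)].

(** A member is determined by its exponents at the primes of m, each below [bitlen q]. *)
Lemma card_smooth q m :
  0 < m -> #|smooth q m| <= bitlen q ^ size (primes m).
Proof.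
move=> m_gt0; pose w := size (primes m).
pose f (n : 'I_q) : {ffun 'I_w -> 'I_(bitlen q)} :=
  [ffun i => inord (logn (nth 0 (primes m) (val i)) n)].
have f_inj : {in smooth q m &, injective f}.
  move=> x y; rewrite !inE => /andP[x_gt0 /allP xm] /andP[y_gt0 /allP ym] /ffunP fE.
  apply/val_inj/eqn_from_log => // p.
  have [pm|npm] := boolP (p \in primes m); last first.
    have aux n : 0 < n -> {in primes n, forall p, p %| m} -> logn p n = 0.
      move=> n_gt0 nm; apply/eqP; rewrite -leqn0 leqNgt logn_gt0.
      apply: contra npm => pn; rewrite mem_primes m_gt0 nm ?andbT //.
      by move: pn; rewrite mem_primes => /and3P[].
    by rewrite !aux.
  have lt_p : index p (primes m) < w by rewrite index_mem.
  have := fE (Ordinal lt_p); rewrite !ffunE /= nth_index // => /(congr1 val).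
  by rewrite /= !inordK ?logn_lt_bitlen // ltnW.
rewrite -(card_in_imset f_inj) (leq_trans (max_card _)) //.
by rewrite card_ffun !card_ord.
Qed.

(** Dyadic splitting: the 2 ^ m values of d in [2 ^ m, 2 ^ m.+1) together contribute at most q. *)
Lemma sum_divn_exp2 q m : \sum_(1 <= d < 2 ^ m) q %/ d <= m * q.
Proof.
elim: m => [|m IHm]; first by rewrite big_geq.
have le_m : 2 ^ m <= 2 ^ m.+1 by rewrite leq_exp2l.
rewrite (@big_cat_nat _ _ _ (2 ^ m)) ?expn_gt0 //= mulSn addnC leq_add //.
apply: (@leq_trans (\sum_(2 ^ m <= d < 2 ^ m.+1) q %/ 2 ^ m)).
  rewrite big_nat_cond [X in _ <= X]big_nat_cond.
  apply: leq_sum => d /andP[/andP[le_d _] _].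
  by rewrite leq_div2l ?expn_gt0.
rewrite sum_nat_const_nat expnS mul2n -addnn addnK mulnC; exact: leq_divM.
Qed.

(** Replace 2 ^ omega(n) by tau(n) and exchange summations: d divides at most q / d of the n. *)
Lemma sum_exp2_size_primes q :
  \sum_(1 <= n < q) 2 ^ size (primes n) <= bitlen q * q.
Proof.
apply: (@leq_trans (\sum_(1 <= n < q) \sum_(1 <= d < q) (d %| n))).
  rewrite big_nat_cond [X in _ <= X]big_nat_cond.
  apply: leq_sum => n /andP[/andP[n_gt0 lt_nq] _].
  apply: leq_trans (exp2_size_primes _ n_gt0) _.
  have -> : \sum_(1 <= d < q) (d %| n) = size [seq d <- index_iota 1 q | d %| n].
    by rewrite size_filter -sum1_count [RHS]big_mkcond; apply: eq_bigr => d _; case: ifP.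
  apply: uniq_leq_size (divisors_uniq _) _ => d; rewrite -dvdn_divisors // => dn.
  rewrite mem_filter dn mem_index_iota (dvdn_gt0 n_gt0 dn) /=.
  by rewrite (leq_ltn_trans (dvdn_leq _ dn)).
rewrite exchange_big /=.
apply: (@leq_trans (\sum_(1 <= d < q) q %/ d)).
  apply: leq_sum => d _; rewrite divn_count_dvd.
  have [->|q_gt0] := posnP q; first by rewrite big_geq.
  by rewrite [X in _ <= X]big_nat_recr //= leq_addr.
apply: leq_trans (sum_divn_exp2 q (bitlen q)).
have [->|q_gt0] := posnP q; first by rewrite big_geq.
rewrite [X in _ <= X](@big_cat_nat _ _ _ q) //=; first exact: leq_addr.
exact: ltnW (ltn_bitlen q).
Qed.

(** Markov's inequality for the preceding sum: each n counted contributes at least 2 ^ w.+1 to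
    it. *)
Lemma card_many_primes q w :
  2 ^ w.+1 * #|[set n : 'I_q | (0 < n) && (w < size (primes n))]| <= bitlen q * q.
Proof.
apply: leq_trans (sum_exp2_size_primes q).
rewrite -sum1_card big_distrr /=.
apply: (@leq_trans (\sum_(n < q | 0 < n) 2 ^ size (primes n))).
  rewrite big_mkcond [X in _ <= X]big_mkcond; apply: leq_sum => n _.
  rewrite inE; case: (0 < n) => //=; case: ifP => // lt_w.
  by rewrite muln1 leq_exp2l.
case: q => [|q]; first by rewrite big_ord0.
rewrite -(big_mkord (fun n => 0 < n) (fun n => 2 ^ size (primes n))).
rewrite big_ltn_cond // ltnn big_nat_cond [X in _ <= X]big_nat_cond.
by rewrite big_mkcond [X in _ <= X]big_mkcond leq_sum // => n _; do 2!case: ifP => //; lia.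
Qed.

(** * Multiplicative relations *)

Lemma logn_prod (I : finType) (P : pred I) (F : I -> nat) p :
    (forall i, P i -> 0 < F i) ->
  logn p (\prod_(i | P i) F i) = \sum_(i | P i) logn p (F i).
Proof.
move=> F_gt0; suff [] : 0 < \prod_(i | P i) F i /\
  logn p (\prod_(i | P i) F i) = \sum_(i | P i) logn p (F i) by [].
elim/big_rec2: _ => [|i m n Pi [m_gt0 <-]]; first by rewrite logn1.
by rewrite muln_gt0 F_gt0 // m_gt0 lognM ?F_gt0.
Qed.

Section Relations.
Local Open Scope ring_scope.

Lemma relation_logn q (S : {set 'I_q}) (a : 'I_q -> int) p :
    (forall i, i \in S -> (0 < i)%N) ->
    \prod_(i in S) ((val i)%:R : rat) ^ (a i) = 1 ->
  \sum_(i in S) a i * (logn p i)%:Z = 0.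
Proof.
move=> S_gt0 rel.
(* Splitting the exponents into positive and negative parts turns the relation into an equation
   between natural numbers, whose valuations can be compared. *)
pose u i := if a i is Posz n then n else 0%N.
pose v i := if a i is Negz n then n.+1 else 0%N.
have aE i : a i = (u i)%:Z - (v i)%:Z.
  by rewrite /u /v; case: (a i) => n; rewrite ?subr0 // NegzE sub0r.
have E : (\prod_(i in S) val i ^ u i = \prod_(i in S) val i ^ v i)%N.
  apply/eqP; rewrite -(eqr_nat rat) !natr_prod.
  apply/eqP; rewrite -[RHS]mul1r -[X in X * _]rel -big_split /=.
  apply: eq_bigr => i iS.
  rewrite !natrX !exprnP -expfzDr; first by rewrite aE subrK.
  by rewrite pnatr_eq0 -lt0n S_gt0.
have := congr1 (logn p) E.
rewrite !logn_prod; last 2 first.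
- by move=> i /S_gt0 i_gt0; rewrite expn_gt0 i_gt0.
- by move=> i /S_gt0 i_gt0; rewrite expn_gt0 i_gt0.
move/(congr1 (fun n => n%:R : int)); rewrite !natr_sum => /eqP.
rewrite -subr_eq0 -sumrB => /eqP E0; rewrite -[RHS]E0.
apply: eq_bigr => i _.
by rewrite !natz !lognX aE mulrBl !PoszM.
Qed.

End Relations.

(** Since a and b are positive, p divides both x and y; as a < b, its exponent in x exceeds that in
    y, so it is at least 2. *)
Lemma dvdn_sqr_of_logn_eq (x y a b : nat) :
    0 < x -> 0 < a < b -> (forall p, a * logn p x = b * logn p y) ->
  forall p, (p \in primes x) || (p \in primes y) -> p ^ 2 %| x.
Proof.
move=> x_gt0 /andP[a_gt0 lt_ab] E p pxy.
have p_pr : prime p by case/orP: pxy; rewrite mem_primes => /and3P[].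
rewrite pfactor_dvdn //; move: pxy (E p); rewrite -!logn_gt0.
by case: (logn p x) (logn p y) => [|[|u]] [|v] //; nia.
Qed.

(* The support of a multiplicative relation; m is the product of the primes
   dividing its members.  Every such prime divides two of them, hence m ^ 2
   divides their product, which is enough as soon as #|A| >= 3.  For #|A| = 2
   one member is a multiple of m ^ 2. *)
Lemma dependent_support q (S : {set 'I_q}) :
    (forall i, i \in S -> 1 < i) -> ~ mult_indep S ->
  exists (A : {set 'I_q}) (m : nat),
    [/\ A \subset S, 1 < #|A|, 0 < m & m ^ 2 <= (q ^ (#|A| - 2)) ^ 2 * q] /\
    A \subset smooth q m /\ size (primes m) <= \sum_(i in A) size (primes i).
Proof.
move=> S_gt1 /existsNP[a /not_implyP[rel /existsNP[i0 /not_implyP[i0S ai0]]]].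
have S_gt0 i : i \in S -> 0 < i by move/S_gt1/ltnW.
pose A := [set i in S | a i != 0%R].
have AS : A \subset S by apply/fintype.subsetP => i; rewrite inE => /andP[].
have A_gt0 i : i \in A -> 0 < i by move/(fintype.subsetP AS)/S_gt0.
have i0A : i0 \in A by rewrite inE i0S; apply/eqP.
have relA p : (\sum_(i in A) a i * (logn p i)%:Z = 0)%R.
  rewrite -[RHS](relation_logn _ _ _ p S_gt0 rel).
  rewrite [RHS](bigID (fun i => a i != 0%R)) /= [X in (_ + X)%R]big1 ?addr0.
    by apply: eq_bigl => i; rewrite inE.
  by move=> i /andP[_ /negPn/eqP ->]; rewrite mul0r.
(* Otherwise the sum in [relA p] would have a single nonzero term. *)
have other p i : i \in A -> p \in primes i ->
    exists2 j, j \in A & (j != i) && (p \in primes j).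
  move=> iA pi; apply/exists_inP; apply: contraT => /exists_inPn none.
  have := relA p; rewrite (bigD1 i) //= big1 ?addr0; last first.
    move=> j /andP[jA ji]; have := none j jA; rewrite ji /= -logn_gt0 -eqn0Ngt.
    by move/eqP ->; rewrite mulr0.
  move/eqP; rewrite mulf_eq0; case/norP; rewrite inE in iA.
  by case/andP: iA => _ ->; rewrite eqz_nat -lt0n logn_gt0.
have card_A : 1 < #|A|.
  have i0_gt1 := S_gt1 _ i0S.
  have [|j jA /andP[ji _]] := other (pdiv i0) i0 i0A.
    by rewrite mem_primes pdiv_prime // pdiv_dvd ltnW.
  by apply/card_gt1P; exists i0, j; rewrite eq_sym.
pose s := undup (flatten [seq primes (val i) | i in A]).
have sP p : reflect (exists2 i, i \in A & p \in primes i) (p \in s).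
  by rewrite mem_undup; apply: flatten_imageP.
have s_pr : all prime s.
  by apply/allP => p /sP[i _]; rewrite mem_primes => /and3P[].
pose m := \prod_(p <- s) p.
have m_gt0 : 0 < m.
  by rewrite /m big_seq_cond prodn_cond_gt0 // => r /andP[/(allP s_pr)/prime_gt0].
have q_gt0 : 0 < q by apply: leq_ltn_trans (ltn_ord i0).
exists A, m; split; split => //; first last.
- apply: leq_trans (size_primes_prod _ s_pr) _.
  apply: leq_trans (size_undup _) _.
  by rewrite size_flatten sumnE /shape big_map big_map big_enum.
- apply/fintype.subsetP => i iA; rewrite inE A_gt0 //=; apply/allP => p pi.
  rewrite prime_dvd_prod_mem //; first by apply/sP; exists i.
  by move: pi; rewrite mem_primes => /and3P[].
have [A2|A_neq2] := eqVneq #|A| 2.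
  rewrite A2 subnn expn0 exp1n mul1n.
  have/eqP/cards2P[x [y [xy AE]]] := A2.
  have xA : x \in A by rewrite AE !inE eqxx.
  have yA : y \in A by rewrite AE !inE eqxx orbT.
  have relE p : `|a x|%N * logn p x = `|a y|%N * logn p y.
    have := relA p; rewrite AE big_setU1 ?inE //= big_set1 => /eqP.
    rewrite addr_eq0 => /eqP/(congr1 absz); by rewrite abszN !abszM.
  have ax : 0 < `|a x| by rewrite absz_gt0; move: xA; rewrite inE => /andP[].
  have ay : 0 < `|a y| by rewrite absz_gt0; move: yA; rewrite inE => /andP[].
  have main (z : 'I_q) : 0 < z ->
      (forall p, (p \in primes x) || (p \in primes y) -> p ^ 2 %| z) -> m ^ 2 <= q.
    move=> z_gt0 dvd_z; apply: leq_trans (ltnW (ltn_ord z)).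
    apply: dvdn_leq => //; apply: prod_sqr_dvdn => //; first exact: undup_uniq.
    move=> p /sP[i]; rewrite AE !inE => /orP[]/eqP -> pi.
      by apply: dvd_z; rewrite pi.
    by apply: dvd_z; rewrite pi orbT.
  have [lt_a|lt_a|eq_a] := ltngtP `|a x| `|a y|.
  - apply: (main x); first exact: A_gt0.
    by apply: (dvdn_sqr_of_logn_eq _ _ _ _ _ _ relE); rewrite ?A_gt0 ?ax.
  - apply: (main y); first exact: A_gt0.
    move=> p; rewrite orbC; move: p.
    apply: (dvdn_sqr_of_logn_eq _ _ `|a y| `|a x|); rewrite ?A_gt0 ?ay //.
  (* Exponents of equal absolute value force equal valuations everywhere, hence x = y. *)
  case/eqP: xy; apply/val_inj/eqn_from_log; rewrite ?A_gt0 // => p.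
  by have := relE p; rewrite eq_a => /eqP; rewrite eqn_pmul2l // => /eqP.
have dvd_prod : m ^ 2 %| \prod_(i in A) val i.
  apply: prod_sqr_dvdn => //; first exact: undup_uniq.
  move=> p /sP[i iA pi]; have [j jA /andP[ji pj]] := other p i iA pi.
  rewrite (bigD1 i) //= (bigD1 j) ?jA //= mulnA dvdn_mulr // dvdn_mul //.
    by move: pi; rewrite mem_primes => /and3P[].
  by move: pj; rewrite mem_primes => /and3P[].
apply: leq_trans (dvdn_leq _ dvd_prod) _; first by rewrite prodn_cond_gt0.
apply: (@leq_trans (\prod_(i in A) q)).
  by apply: leq_prod => i _; apply: ltnW (ltn_ord i).
(* As #|A| is at least 3, it is at most 2 * (#|A| - 2) + 1. *)
by rewrite prod_nat_const -expnM -expnSr leq_pexp2l //; lia.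
Qed.

(** Here s is an integer upper bound for the square root of q. A dependent set is A :|: B with A a
    support of size r inside [smooth q m] for some m at most q ^ (r - 2) * s, and B a set of size k
    - r. The factor q ^ 2 on the left avoids k - 2, which truncates for k < 2. *)
Lemma card_dependent (q k w s : nat) (N : {set 'I_q}) :
    q <= s ^ 2 -> (forall i, i \in N -> 1 < i) ->
    (forall i, i \in N -> size (primes i) <= w) ->
  #|[set S : {set 'I_q} |
      (S \subset N) && (#|S| == k) && ~~ `[< mult_indep S >]]| * q ^ 2
    <= 2 * k * s * q ^ k * bitlen q ^ (k * w * k).
Proof.
move=> qs N_gt1 N_w; set D := [set S | _].
have [q0|q_gt0] := posnP q; first by rewrite (_ : q ^ 2 = 0) ?muln0 // q0.
have s_gt0 : 0 < s by case: (s) qs => //; rewrite leqNgt q_gt0.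
pose F (r m : nat) : {set {set 'I_q}} :=
  [set A :|: B | A in [set A : {set 'I_q} | (A \subset smooth q m) && (#|A| == r)],
                 B in [set B : {set 'I_q} | #|B| == k - r]].
pose good m := (0 < m) && (size (primes m) <= k * w).
have F_le r m : r <= k -> good m ->
    #|F r m| <= bitlen q ^ (k * w * k) * q ^ (k - r).
  move=> le_rk /andP[m_gt0 le_m]; rewrite /F curry_imset2X.
  apply: leq_trans (leq_imset_card _ _) _; rewrite cardsX leq_mul //.
    rewrite cards_draws (leq_trans (bin_leq_expn _ _)) //.
    apply: (@leq_trans ((bitlen q ^ (k * w)) ^ r)); last first.
      by rewrite -expnM leq_pexp2l // leq_mul2l le_rk orbT.
    have [->|r_gt0] := posnP r; first by rewrite !expn0.
    rewrite leq_exp2r //; apply: leq_trans (card_smooth _ _ m_gt0) _.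
    by rewrite leq_pexp2l.
  by rewrite card_draws card_ord bin_leq_expn.
have D_sub : D \subset \bigcup_(r < k.+1 | 1 < r)
    \bigcup_(m < (q ^ (r - 2) * s).+1 | good m) F r m.
  apply/fintype.subsetP => S; rewrite inE => /andP[/andP[SN /eqP cardS] /asboolPn dep].
  have S_gt1 i : i \in S -> 1 < i by move/(fintype.subsetP SN)/N_gt1.
  have [A [m [[AS A_gt1 m_gt0 m_le] [Am m_primes]]]] := dependent_support _ _ S_gt1 dep.
  have le_Ak : #|A| < k.+1 by rewrite ltnS -cardS subset_leq_card.
  have lt_m : m < (q ^ (#|A| - 2) * s).+1.
    rewrite ltnS -(@leq_exp2r _ _ 2) // expnMn (leq_trans m_le) //.
    by rewrite leq_mul2l qs orbT.
  apply/bigcupP; exists (Ordinal le_Ak) => //.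
  apply/bigcupP; exists (Ordinal lt_m).
    rewrite /good m_gt0 (leq_trans m_primes) //.
    apply: (@leq_trans (\sum_(i in A) w)).
      by apply: leq_sum => i /(fintype.subsetP AS)/(fintype.subsetP SN)/N_w.
    by rewrite sum_nat_const leq_mul2r -ltnS le_Ak orbT.
  apply/imset2P; exists A (S :\: A); rewrite ?inE ?Am ?eqxx //.
    by rewrite cardsD (finset.setIidPr AS) cardS.
  by rewrite finset.setDE finset.setUIr finset.setUCr finset.setIT; apply/esym/finset.setUidPr.
have le_D : #|D| <= \sum_(r < k.+1 | 1 < r)
    (q ^ (r - 2) * s).+1 * (bitlen q ^ (k * w * k) * q ^ (k - r)).
  apply: leq_trans (subset_leq_card D_sub) _.
  apply: leq_trans (leq_card_bigcup _ _ _ _) _; apply: leq_sum => r _.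
  apply: leq_trans (leq_card_bigcup _ _ _ _) _.
  apply: leq_trans (leq_sum _ _) _; first by move=> m; apply: F_le; rewrite -ltnS.
  by rewrite sum_nat_const leq_mul2r -[X in _ <= X]card_ord max_card orbT.
apply: (@leq_trans (\sum_(r < k.+1 | 1 < r)
    (2 * s * q ^ k * bitlen q ^ (k * w * k)))).
  rewrite -leq_divRL ?expn_gt0 ?q_gt0 // (leq_trans le_D) //.
  rewrite leq_divRL ?expn_gt0 ?q_gt0 // big_distrl /=.
  apply: leq_sum => r r_gt1; have le_rk : r <= k by rewrite -ltnS.
  have -> : q ^ k = q ^ (r - 2) * q ^ (k - r) * q ^ 2.
    by rewrite -!expnD; congr expn; lia.
  (* The range of m includes 0; the factor 2 absorbs this extra value. *)
  have : (q ^ (r - 2) * s).+1 <= 2 * (q ^ (r - 2) * s).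
    by rewrite mul2n -addnn -addn1 leq_add2l muln_gt0 expn_gt0 q_gt0.
  set W := bitlen q ^ _; set x := q ^ (r - 2); set y := q ^ (k - r).
  set z := q ^ 2; rewrite -!(mulnA (x * s).+1) => le_x.
  have -> : 2 * s * (x * y * z) * W = 2 * (x * s) * (W * y * z).
    by rewrite -!mulnA; congr (2 * _); lia.
  by rewrite leq_mul2r le_x orbT.
rewrite sum_nat_const; set c := #|_|.
(* The index r = 0 never occurs, so at most k of the k.+1 indices remain. *)
have le_c : c <= k.
  rewrite /c (leq_trans (subset_leq_card (_ : _ \subset [set~ ord0]))) //.
    by apply/fintype.subsetP => r; rewrite !inE; apply: contraL => /eqP ->.
  by rewrite cardsC1 card_ord.
by rewrite [2 * k]mulnC -!mulnA leq_mul2r le_c orbT.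
Qed.

(** * The set of integers with few prime factors *)

(** An integer substitute l for log_2 q. It dominates [log2] for large q, so errors of order 1 / l
    are admissible. *)
Definition loglen (q : nat) : nat := up_log 2 (bitlen q).

(** The threshold makes 2 ^ (2 * l) at least L ^ 2, with L the bit length, which beats the factor L
    in [card_many_primes]. *)
Definition few_primes (q : nat) : {set 'I_q} :=
  [set n : 'I_q | (1 < n) && (size (primes n) <= 2 * loglen q)].

Lemma bitlen_leq_exp2 q : bitlen q <= 2 ^ loglen q.
Proof. exact: up_logP. Qed.

Lemma exp2_lt_bitlen q : 0 < loglen q -> 2 ^ (loglen q).-1 < bitlen q.
Proof. by rewrite /loglen up_log_gt0 => /andP[_]; apply: up_log_gtn. Qed.

Lemma loglen_unbounded M q : 2 ^ 2 ^ M <= q -> M <= loglen q.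
Proof.
move=> le_q; rewrite -(@up_expnK 2 M) //; apply: leq_up_log.
by rewrite leqW // trunc_log_max.
Qed.

(** Source of the threshold 16 below: 16 ^ 4 = 2 ^ 16, and from there on each step multiplies n ^ 4
    by less than 2. *)
Lemma expn4_leq_exp2 n : 16 <= n -> n ^ 4 <= 2 ^ n.
Proof.
elim: n => // n IHn; rewrite leq_eqVlt => /orP[/eqP <-|].
  by rewrite -[X in X ^ 4 <= _]/(2 ^ 4) -expnM.
rewrite ltnS => n_ge; apply: leq_trans (_ : 2 * n ^ 4 <= _); last first.
  by rewrite [2 ^ _]expnS leq_mul2l IHn.
rewrite !expnS !expn0 !muln1; nia.
Qed.

(** Minimality of l gives 2 ^ l < 2 * L. This is what makes 2 ^ O(l ^ 3) a factor q ^ o(1). *)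
Lemma loglen_pow4_lt q : 16 <= loglen q -> loglen q ^ 4 < 2 * bitlen q.
Proof.
move=> l_ge; apply: leq_ltn_trans (expn4_leq_exp2 _ l_ge) _.
have l_gt0 : 0 < loglen q by apply: leq_trans l_ge.
by rewrite -{1}(prednK l_gt0) expnS ltn_mul2l /= exp2_lt_bitlen.
Qed.

(** At most q / (2 * L) integers have too many prime factors; 0 and 1 account for the term 4 * L. *)
Lemma card_few_primes_compl q : (q - #|few_primes q|) * (2 * bitlen q) <= q + 4 * bitlen q.
Proof.
set N := few_primes q; set L := bitlen q.
pose bad := [set n : 'I_q | (0 < n) && (2 * loglen q < size (primes n))].
pose small := [set n : 'I_q | n < 2].
have card_small : #|small| <= 2.
  pose f (n : 'I_q) : 'I_2 := inord n.
  have f_inj : {in small &, injective f}.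
    move=> x y; rewrite !inE => x2 y2 /(congr1 val).
    by rewrite /= !inordK // => /val_inj.
  by rewrite -(card_in_imset f_inj) -[X in _ <= X]card_ord max_card.
have card_bad : #|bad| * (2 * L) <= q.
  have := card_many_primes q (2 * loglen q); rewrite -/bad -/L => le_bad.
  have LL : L * L <= 2 ^ (2 * loglen q).
    by rewrite mul2n -addnn expnD leq_mul ?bitlen_leq_exp2.
  have L_gt0 : 0 < L by [].
  rewrite -(leq_pmul2l L_gt0); apply: leq_trans le_bad; rewrite expnS; nia.
have : q <= #|N| + (#|bad| + #|small|).
  rewrite -{1}(card_ord q) -(cardsC N) leq_add2l.
  apply: leq_trans (leq_card_setU _ _); apply: subset_leq_card.
  by apply/fintype.subsetP => n; rewrite !inE; lia.
nia.
Qed.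

Lemma gt0_of_loglen_gt0 q : 0 < loglen q -> 0 < q.
Proof. by case: q. Qed.

Lemma bitlen_leq_self q : 0 < q -> bitlen q <= q.
Proof. by move=> q_gt0; apply: leq_trans (bitlen_leq _ q_gt0); apply: ltn_expl. Qed.

Lemma loglen_pow4_bounds q : 16 <= loglen q ->
  [/\ 0 < q, bitlen q <= q, 8 * loglen q < bitlen q &
      8 * loglen q ^ 3 < bitlen q].
Proof.
move=> l_ge; have q_gt0 : 0 < q by apply: gt0_of_loglen_gt0; apply: leq_trans l_ge.
split=> //; first exact: bitlen_leq_self.
  have := loglen_pow4_lt q l_ge; rewrite expnSr.
  have : 16 <= loglen q ^ 3.
    by apply: leq_trans (l_ge) _; rewrite -{1}[loglen q]expn1 leq_pexp2l //; apply: leq_trans l_ge.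
  by move: (loglen q ^ 3) => l3; nia.
by have := loglen_pow4_lt q l_ge; rewrite expnSr; nia.
Qed.

(** The gap between l and L absorbs the term 4 * L; the factor 2 later yields the implied constant
    1/2. *)
Lemma card_few_primes_loglen q :
  16 <= loglen q -> (q - #|few_primes q|) * (2 * loglen q) <= q.
Proof.
move=> l_ge; have [q_gt0 le_Lq lt_l _] := loglen_pow4_bounds q l_ge.
have := card_few_primes_compl q; set d := q - _.
have L_gt0 : 0 < bitlen q by [].
rewrite -[_ <= q](leq_pmul2l L_gt0).
move: (loglen q) (bitlen q) lt_l le_Lq L_gt0 => l L lt_l le_Lq L_gt0 le_d.
have -> : L * (d * (2 * l)) = l * (d * (2 * L)) by lia.
apply: leq_trans (_ : l * (q + 4 * L) <= _); first by rewrite leq_mul2l le_d orbT.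
nia.
Qed.

Lemma few_primes_half q : 16 <= loglen q -> q <= 2 * #|few_primes q|.
Proof. by move=> l_ge; have := card_few_primes_loglen q l_ge; nia. Qed.

Lemma card_few_primes_leq q : #|few_primes q| <= q.
Proof. by rewrite -[X in _ <= X]card_ord max_card. Qed.

(** * Counting dependent subsets *)

Definition dependents (q k : nat) : {set {set 'I_q}} :=
  [set S : {set 'I_q} |
    (S \subset few_primes q) && (#|S| == k) && ~~ `[< mult_indep S >]].

Lemma count_indep_few_primes q k :
  count_indep (few_primes q) k + #|dependents q k| = 'C(#|few_primes q|, k).
Proof.
rewrite -cards_draws -(cardsID [set S | `[< mult_indep S >]]).
by congr (_ + _); apply: eq_card => S; rewrite !inE // andbC.
Qed.

(* Here s := 2 ^ uphalf (bitlen q) replaces the square root of q: its square lies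
   between q and 4 q. *)
Lemma card_dependents q k : 16 <= loglen q -> k * k <= loglen q ->
  exists s, [/\ s <= q, s ^ 2 <= 4 * q &
    #|dependents q k| * q ^ 2 <= s * q ^ k * 2 ^ (2 * loglen q ^ 3 + loglen q + 1)].
Proof.
move=> l_ge k_le; have [q_gt0 le_Lq lt_l _] := loglen_pow4_bounds q l_ge.
set l := loglen q in l_ge k_le lt_l *; set L := bitlen q in le_Lq lt_l.
exists (2 ^ uphalf L).
have s2_le : (2 ^ uphalf L) ^ 2 <= 4 * q.
  apply: leq_trans (_ : 4 * 2 ^ L.-1 <= _); last by rewrite leq_mul2l bitlen_leq.
  rewrite -[X in X * _]/(2 ^ 2) -expnD -expnM leq_exp2l //.
  by have := uphalf_half L; have := odd_double_half L; rewrite -/L; lia.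
split=> //.
  by rewrite -(@leq_exp2r _ _ 2) // (leq_trans s2_le) // expnS expn1 leq_mul2r; lia.
have q_le : q <= (2 ^ uphalf L) ^ 2.
  apply: leq_trans (ltnW (ltn_bitlen q)) _; rewrite -expnM leq_exp2l //.
  by have := uphalf_half L; have := odd_double_half L; rewrite -/L; lia.
have N_gt1 i : i \in few_primes q -> 1 < i by rewrite inE => /andP[].
have N_w i : i \in few_primes q -> size (primes i) <= 2 * l by rewrite inE => /andP[].
apply: leq_trans (card_dependent q k (2 * l) _ _ q_le N_gt1 N_w) _.
have le_kl : k <= 2 ^ l by apply: leq_trans (ltnW (ltn_expl l _)) => //; nia.
have le_W : L ^ (k * (2 * l) * k) <= 2 ^ (2 * l ^ 3).
  apply: (@leq_trans ((2 ^ l) ^ (k * (2 * l) * k))).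
    by case: (k * _ * k) => // e; rewrite leq_exp2r ?bitlen_leq_exp2.
  rewrite -expnM leq_exp2l // !expnS expn0; nia.
(* The three summands of the exponent account for the power of L, for k and for the factor 2. *)
rewrite -/L 2!expnD expn1.
have := leq_mul le_kl le_W; set W := _ ^ (k * _ * _); set W' := 2 ^ (2 * _).
move: (2 ^ uphalf L) (q ^ k) (2 ^ l) => s Q T le_TW.
have -> : 2 * k * s * Q * W = 2 * s * Q * (k * W) by lia.
have -> : s * Q * (W' * T * 2) = 2 * s * Q * (T * W') by lia.
by rewrite leq_mul2l le_TW orbT.
Qed.

(** Binary logarithm of the total loss: 2 * l ^ 3 + l + 1 from [card_dependents], l from q ^ k <= 2
    ^ l * N ^ k with N := #|few_primes q|, and 1 from s <= 2 * sqrt q. *)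
Definition loss_exponent (l : nat) : nat := 2 * l ^ 3 + 2 * l + 2.

Lemma loss_exponent_small q : 16 <= loglen q ->
  loss_exponent (loglen q) * loglen q <= 24 * (bitlen q - 2).
Proof.
move=> l_ge; have := loglen_pow4_lt q l_ge; rewrite expnSr /loss_exponent.
have : loglen q <= loglen q ^ 3.
  by rewrite -{1}[loglen q]expn1 leq_pexp2l //; apply: leq_trans l_ge.
by move: (loglen q) (bitlen q) (loglen q ^ 3) l_ge; nia.
Qed.

(** Squared and cleared of denominators to stay in [nat], this is D <= 2 ^ E * N ^ (k - 3/2), where
    D counts the dependent sets and E is the loss exponent. *)
Lemma card_dependents_sqr q k : 16 <= loglen q -> k * k <= loglen q ->
  #|dependents q k| ^ 2 * #|few_primes q| ^ 3
    <= (2 ^ loss_exponent (loglen q) * #|few_primes q| ^ k) ^ 2.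
Proof.
move=> l_ge k_le; have [q_gt0 _ _ _] := loglen_pow4_bounds q l_ge.
have [s [_ s2_le]] := card_dependents q k l_ge k_le.
set D := #|dependents q k|; set N := #|few_primes q|; set T := 2 ^ (_ + _ + _).
move=> D_le.
have Q_le : q ^ k <= 2 ^ loglen q * N ^ k.
  apply: leq_trans (_ : (2 * N) ^ k <= _).
    by case: (k) => // j; rewrite leq_exp2r ?few_primes_half.
  rewrite expnMn leq_mul2r leq_exp2l //; apply/orP; right; nia.
have N3 : N ^ 3 <= q ^ 3 by rewrite leq_exp2r ?card_few_primes_leq.
have D2 : D ^ 2 * q ^ 3 <= (2 * (q ^ k * T)) ^ 2.
  rewrite -(leq_pmul2r q_gt0).
  apply: leq_trans (_ : (s * q ^ k * T) ^ 2 <= _).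
    by rewrite -mulnA -expnSr (expnM q 2 2) -expnMn leq_exp2r.
  rewrite -mulnA !expnMn mulnAC leq_mul2r; apply/orP; right.
  by rewrite -[2 ^ 2]/4.
apply: leq_trans (_ : D ^ 2 * q ^ 3 <= _); first by rewrite leq_mul2l N3 orbT.
apply: leq_trans D2 _; rewrite leq_exp2r //.
have -> : 2 ^ loss_exponent (loglen q) = 2 * T * 2 ^ loglen q.
  by rewrite -expnS -expnD /loss_exponent; congr expn; lia.
rewrite -!mulnA leq_mul2l /= mulnC leq_mul2l Q_le orbT //.
Qed.

Lemma fact_leq_expn n : n`! <= n ^ n.
Proof. by rewrite -ffactnn ffact_leq_expn. Qed.

(** The crude bound s <= q gives D * q <= q ^ k * T with T = 2 ^ O(l ^ 3), and T * (k-1)! * l stays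
    below q because 8 * l ^ 3 < L. *)
Lemma card_dependents_fact q k : 16 <= loglen q -> k * k <= loglen q ->
  #|dependents q k| * ((k.-1)`! * loglen q) <= q ^ k.
Proof.
move=> l_ge k_le; have [q_gt0 _ _ lt_L] := loglen_pow4_bounds q l_ge.
have [s [s_le _]] := card_dependents q k l_ge k_le.
set D := #|dependents q k|; set T := 2 ^ (_ + _ + _); move=> D_le.
have le_kl : k <= loglen q by nia.
have T_le : T * ((k.-1)`! * loglen q) <= q.
  apply: leq_trans (bitlen_leq _ q_gt0).
  apply: (@leq_trans (T * (2 ^ (loglen q * loglen q) * 2 ^ loglen q))).
    rewrite leq_mul2l leq_mul ?orbT //; last exact/ltnW/ltn_expl.
    apply: leq_trans (fact_leq_expn _) _.
    apply: (@leq_trans ((2 ^ loglen q) ^ k.-1)).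
      case: (k.-1) (leq_pred k) => // j le_j; rewrite leq_exp2r //.
      by apply: leq_trans (ltnW (ltn_expl (loglen q) _)) => //; lia.
    by rewrite -expnM leq_exp2l // leq_mul2l; lia.
  rewrite -!expnD leq_exp2l //; move: lt_L; rewrite !expnS expn0; nia.
have Dq : D * q <= q ^ k * T.
  rewrite -(leq_pmul2r q_gt0) -mulnA; apply: leq_trans D_le _.
  by rewrite -mulnA mulnC leq_mul2l s_le orbT.
rewrite -(leq_pmul2r q_gt0) mulnAC.
apply: (@leq_trans (q ^ k * T * ((k.-1)`! * loglen q))).
  by rewrite leq_mul2r Dq orbT.
by rewrite -mulnA leq_mul2l T_le orbT.
Qed.

(** Bernoulli's inequality (1 - y) ^ k >= 1 - k * y at y = d / (x + d), cleared of denominators. *)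
Lemma bernoulli_expn x d k :
  (x + d) ^ k * (x + d) <= x ^ k * (x + d) + k * d * (x + d) ^ k.
Proof.
elim: k => [|k IHk]; first by rewrite !expn0; lia.
have : x ^ k <= (x + d) ^ k by case: (k) => // j; rewrite leq_exp2r ?leq_addr.
rewrite !expnS; move: (x ^ k) ((x + d) ^ k) IHk => u v; nia.
Qed.

Lemma ffact_few_primes q k : 16 <= loglen q -> k * k <= loglen q ->
  q ^ k * loglen q <= #|few_primes q| ^_ k * loglen q + k * q ^ k.
Proof.
move=> l_ge k_le; have [q_gt0 le_Lq _ lt_L] := loglen_pow4_bounds q l_ge.
have := card_few_primes_loglen q l_ge; have := card_few_primes_leq q.
have := ffact_geq_expn #|few_primes q| k.
set N := #|few_primes q|; set l := loglen q in l_ge k_le lt_L *; set x := N - k.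
move=> F_ge N_le dN.
have qE : q = x + (q - x) by lia.
(* Both q - N and k are at most q / (2 * l). *)
have d_le : (q - x) * l <= q.
  have : k * (2 * l) <= q.
    apply: leq_trans le_Lq; move: lt_L; rewrite !expnS expn0; nia.
  have : q - x <= (q - N) + k by lia.
  by move: (q - N) (q - x) dN => a b; nia.
have := bernoulli_expn x (q - x) k; rewrite -qE => B.
rewrite -(leq_pmul2r q_gt0).
apply: (@leq_trans ((x ^ k * q + k * (q - x) * q ^ k) * l)).
  by rewrite mulnAC leq_mul2r B orbT.
apply: (@leq_trans (x ^ k * l * q + k * q ^ k * q)).
  rewrite mulnDl mulnAC leq_add2l.
  have -> : k * (q - x) * q ^ k * l = k * q ^ k * ((q - x) * l) by lia.
  by rewrite leq_mul2l d_le orbT.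
by rewrite mulnDl leq_add2r !leq_mul2r F_ge !orbT.
Qed.

(** * Asymptotics *)

Local Open Scope classical_set_scope.
Local Open Scope ring_scope.

Lemma ln_le_exp2 (R : realType) (x : R) (m : nat) : x <= 2 ^+ m -> ln x <= m%:R.
Proof.
have [x_le0 _|x_gt0 x_le] := leP x 0; first by rewrite ln0 // ler0n.
have ln2 : ln (2 : R) <= 1 by have := @le_ln1Dx R 1; apply; lra.
apply: le_trans (_ : ln (2 ^+ m) <= _).
  by rewrite ler_ln // posrE // exprn_gt0 // ltr0n.
by rewrite lnXn ?ltr0n // lerMn2r ln2 orbT.
Qed.

(** Natural logarithms are bounded by binary ones, twice; l >= 16 takes care of the cut-off 2 in
    [logm]. *)
Lemma log2_le_loglen (R : realType) q :
  (16 <= loglen q)%N -> log2 (q%:R : R) <= (loglen q)%:R.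
Proof.
move=> l_ge; have [_ _ lt_l _] := loglen_pow4_bounds q l_ge.
rewrite /log2 {1}/logm ge_max; apply/andP; split; last by rewrite ler_nat; lia.
apply: ln_le_exp2; apply: le_trans (_ : (bitlen q)%:R <= _); last first.
  by rewrite -natrX ler_nat bitlen_leq_exp2.
rewrite /logm ge_max; apply/andP; split; last by rewrite ler_nat; lia.
by apply: ln_le_exp2; rewrite -natrX ler_nat ltnW ?ltn_bitlen.
Qed.

Lemma log2_gt0 (R : realType) (x : R) : 0 < log2 x.
Proof. by rewrite /log2 {1}/logm lt_max ltr0n orbT. Qed.

Lemma near_loglen M : \forall q \near \oo, (M <= loglen q)%N.
Proof. by exists (2 ^ 2 ^ M)%N => // q /=; apply: loglen_unbounded. Qed.

Lemma near_loglen_ge (R : realType) (x : R) :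
  \forall q \near \oo, x <= (loglen q)%:R.
Proof.
have := near_loglen (Num.bound `|x|); apply: filterS => q le_q.
apply: le_trans (ler_norm x) (le_trans (ltW (archi_boundP (normr_ge0 x))) _).
by rewrite ler_nat.
Qed.

Lemma few_primes_close (R : realType) q : (16 <= loglen q)%N ->
  `|(#|few_primes q|)%:R - (q%:R : R)| <= 2^-1 * q%:R / log2 (q%:R : R).
Proof.
move=> l_ge; have le_N := card_few_primes_leq q.
rewrite distrC ger0_norm ?subr_ge0 ?ler_nat // -natrB //.
rewrite ler_pdivlMr ?log2_gt0 //.
apply: le_trans (_ : (q - #|few_primes q|)%:R * (loglen q)%:R <= _).
  by rewrite ler_wpM2l ?ler0n ?log2_le_loglen.
have : ((q - #|few_primes q|) * (2 * loglen q))%:R <= (q%:R : R).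
  by rewrite ler_nat card_few_primes_loglen.
by rewrite !natrM; lra.
Qed.

(** Chosen so that 2 ^ E equals (2 ^ (L - 2)) ^ eps, which is at most N ^ eps because N >= q / 2 >=
    2 ^ (L - 2). *)
Definition eps_loss (R : realType) (q : nat) : R :=
  (loss_exponent (loglen q))%:R / (bitlen q - 2)%:R.

Lemma eps_loss_cvg (R : realType) : eps_loss R @ \oo --> (0 : R).
Proof.
apply/cvgrPdist_le => e e_gt0; near=> q.
have l_ge : (16 <= loglen q)%N by near: q; exact: near_loglen.
have l_e : 24 / e <= (loglen q)%:R by near: q; exact: near_loglen_ge.
have [_ _ lt_l _] := loglen_pow4_bounds q l_ge.
have L_gt0 : 0 < (bitlen q - 2)%:R :> R by rewrite ltr0n; lia.
have l_gt0 : 0 < (loglen q)%:R :> R by rewrite ltr0n; lia.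
rewrite sub0r normrN ger0_norm ?divr_ge0 ?ler0n // /eps_loss ler_pdivrMr //.
rewrite -(ler_pM2r l_gt0).
apply: le_trans (_ : 24 * (bitlen q - 2)%:R <= _).
  by rewrite -!natrM ler_nat loss_exponent_small.
by rewrite mulrAC ler_wpM2r ?ler0n // mulrC -ler_pdivrMr.
Unshelve. all: by end_near. Qed.

Lemma dependents_powR (R : realType) q k :
    (16 <= loglen q)%N -> (k * k <= loglen q)%N ->
  (#|dependents q k|)%:R
    <= powR (#|few_primes q|)%:R (k%:R - 3 / 2 + eps_loss R q).
Proof.
move=> l_ge k_le; have [q_gt0 le_Lq lt_l _] := loglen_pow4_bounds q l_ge.
have half := few_primes_half q l_ge; have := card_dependents_sqr q k l_ge k_le.
set D := #|dependents q k|; set N := #|few_primes q| in half *.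
set E := loss_exponent _ => D_le.
have N_gt0 : 0 < (N%:R : R) by rewrite ltr0n; lia.
have N_neq0 : (N%:R : R) != 0 by rewrite gt_eqF.
rewrite !powRD ?N_neq0 ?implybT // powR_mulrn ?ler0n //.
set z := powR _ (- _); set t := powR _ (eps_loss _ _).
have t_ge : (2 ^ E)%:R <= t.
  have L_gt0 : 0 < (bitlen q - 2)%:R :> R by rewrite ltr0n; lia.
  apply: le_trans (_ : powR ((2 ^ (bitlen q - 2))%:R) (eps_loss R q) <= _).
    rewrite !natrX -(@powR_mulrn R 2 (bitlen q - 2)) ?ler0n // -powRrM /eps_loss -/E.
    by rewrite mulrC divfK ?gt_eqF // powR_mulrn ?ler0n.
  apply: ge0_ler_powR; rewrite ?nnegrE ?ler0n ?divr_ge0 ?ler0n // ler_nat.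
  have := bitlen_leq _ q_gt0.
  have -> : (bitlen q).-1 = (bitlen q - 2).+1 by lia.
  rewrite expnS; lia.
have z_gt0 : 0 < z by rewrite powR_gt0.
(* z is N ^ (- 3/2); its square cancels N ^ 3 once the goal is squared to match
   [card_dependents_sqr]. *)
have zN : z ^+ 2 * N%:R ^+ 3 = 1.
  rewrite -!powR_mulrn ?ltW // -powRrM -powRD ?N_neq0 ?implybT //.
  by rewrite (_ : _ + _ = 0) ?powRr0 //; lra.
apply: le_trans (_ : (2 ^ E)%:R * N%:R ^+ k * z <= _); last first.
  by rewrite -mulrA mulrC ler_wpM2l // mulr_ge0 ?exprn_ge0 ?ler0n ?ltW.
have N3_gt0 : 0 < (N%:R : R) ^+ 3 by rewrite exprn_gt0.
rewrite -ler_sqr ?nnegrE ?ler0n //; last first.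
  by rewrite !mulr_ge0 ?ler0n ?exprn_ge0 ?ltW.
rewrite -(ler_pM2r N3_gt0) exprMn -[leRHS]mulrA zN mulr1.
by rewrite -!natrX -!natrM -natrX ler_nat.
Qed.

(** After multiplication by k!, the count is at most q ^ k and falls short of it by at most k * q ^
    k / l twice: once for N ^_ k against q ^ k, once for the dependent sets. Dividing by k! leaves 2
    / (k-1)!. *)
Lemma count_indep_close (R : realType) q k : (0 < k)%N ->
    (16 <= loglen q)%N -> (k * k <= loglen q)%N ->
  `| ((count_indep (few_primes q) k)%:R : R) - (q%:R : R) ^+ k / (k`!)%:R |
     <= 2 * (q%:R : R) ^+ k / ((k.-1)`!%:R * log2 (q%:R : R)).
Proof.
move=> k_gt0 l_ge k_le.
have lg_gt0 := log2_gt0 R q%:R; have lg_le := log2_le_loglen R q l_ge.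
have cE := count_indep_few_primes q k.
have D_le := card_dependents_fact q k l_ge k_le.
have F_ge := ffact_few_primes q k l_ge k_le.
have F_le : (#|few_primes q| ^_ k <= q ^ k)%N.
  apply: leq_trans (ffact_leq_expn _ _) _.
  by rewrite leq_exp2r ?card_few_primes_leq.
rewrite -bin_ffact -cE in F_ge F_le.
have kE : (k`! = k * (k.-1)`!)%N by rewrite -{1}(prednK k_gt0) factS prednK.
rewrite kE in F_ge F_le *.
move: (count_indep _ _) (#|dependents q k|) D_le F_ge F_le => c D D_le F_ge F_le.
have f_gt0 : (0 < (k.-1)`!)%N := fact_gt0 _.
move: ((k.-1)`!)%N f_gt0 D_le F_ge F_le => f f_gt0 D_le F_ge F_le {cE kE}.
rewrite -natrX; move: (q ^ k)%N D_le F_ge F_le => Q D_le F_ge F_le.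
set l := loglen q in l_ge k_le D_le F_ge lg_le.
have fR : 0 < (f%:R : R) by rewrite ltr0n.
have kR : 0 < (k%:R : R) by rewrite ltr0n.
have lR : 0 < (l%:R : R) by rewrite ltr0n; lia.
apply: le_trans (_ : 2 * Q%:R / (f%:R * l%:R) <= _); last first.
  rewrite ler_wpM2l ?mulr_ge0 ?ler0n // lef_pV2 ?posrE ?mulr_gt0 //.
  by rewrite ler_pM2l.
have d_gt0 : 0 < (k%:R * f%:R * l%:R : R) by rewrite !mulr_gt0.
rewrite -(ler_pM2r d_gt0) -[X in `|_| * X]gtr0_norm // -normrM.
rewrite natrM.
have -> : (c%:R - Q%:R / (k%:R * f%:R)) * (k%:R * f%:R * l%:R)
   = (c * (k * f) * l)%:R - (Q * l)%:R :> R.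
  by rewrite !natrM; field; rewrite ?gt_eqF.
have -> : 2 * Q%:R / (f%:R * l%:R) * (k%:R * f%:R * l%:R) = (2 * k * Q)%:R :> R.
  by rewrite !natrM; field; rewrite ?gt_eqF.
have up : (c * (k * f) * l <= Q * l)%N by nia.
rewrite distrC ger0_norm ?subr_ge0 ?ler_nat // lerBlDl -natrD ler_nat.
apply: leq_trans F_ge _.
rewrite !mulnDl -addnA leq_add2l.
have : (k * (D * (f * l)) <= k * Q)%N by rewrite leq_mul2l D_le orbT.
nia.
Qed.

(** The factor [1 *] matches the little-o hypothesis at e = 1; squaring gives k ^ 2 <= log_2 q <=
    l. *)
Lemma loglen_ge_sqr (R : realType) q k : (16 <= loglen q)%N ->
  (k%:R : R) <= 1 * Num.sqrt (log2 (q%:R : R)) -> (k * k <= loglen q)%N.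
Proof.
move=> l_ge k_le; rewrite -(ler_nat R) natrM -expr2.
apply: le_trans (log2_le_loglen R q l_ge).
have lg_ge0 := ltW (log2_gt0 R q%:R).
by rewrite -(sqr_sqrtr lg_ge0) ler_sqr ?nnegrE ?ler0n ?sqrtr_ge0 // -[leRHS]mul1r.
Qed.

Theorem theorem1p3 (R : realType) :
  exists N : forall q : nat, {set 'I_q},
    (* N_q is a subset of {2, ..., q-1} *)
    (forall q (i : 'I_q), i \in N q -> (2 <= val i)%N) /\
    (* #N_q = q + O(q / log_2 q) with implied constant < 1 *)
    (exists C : R, C < 1 /\
       \forall q \near \oo,
          `| (#|N q|)%:R - (q%:R : R) | <= C * q%:R / log2 (q%:R : R)) /\
    (* for every k = k(q) positive with k = o(sqrt(log_2 q)) *)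
    (forall k : nat -> nat,
       (\forall q \near \oo, (0 < k q)%N) ->
       (forall e : R, 0 < e ->
          \forall q \near \oo, ((k q)%:R : R) <= e * Num.sqrt (log2 (q%:R : R))) ->
       (* count = binom(#N_q, k) + O(#N_q^{k - 3/2 + o(1)}) *)
       (exists (eps : nat -> R) (C : R),
          eps @ \oo --> 0 /\
          \forall q \near \oo,
             `| ((count_indep (N q) (k q))%:R : R) - ('C(#|N q|, k q))%:R |
               <= C * powR (#|N q|)%:R ((k q)%:R - 3 / 2 + eps q)) /\
       (* count = q^k / k! + O(q^k / ((k-1)! log_2 q)) *)
       (exists C : R,
          \forall q \near \oo,
             `| ((count_indep (N q) (k q))%:R : R) - (q%:R : R) ^+ (k q) / ((k q)`!)%:R |
               <= C * (q%:R : R) ^+ (k q) / (((k q).-1)`!%:R * log2 (q%:R : R)))).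
Proof.
exists few_primes; split; first by move=> q i; rewrite inE => /andP[].
split.
  exists 2^-1; split; first lra.
  by have := near_loglen 16; apply: filterS => q; apply: few_primes_close.
move=> k k_gt0 /(_ 1 ltr01) k_le; split.
  exists (eps_loss R), 1; split; first exact: (@eps_loss_cvg R).
  near=> q; have l_ge : (16 <= loglen q)%N by near: q; exact: near_loglen.
  (* The binomial coefficient exceeds the count by exactly the number of dependent sets. *)
  rewrite mul1r -count_indep_few_primes natrD opprD addNKr normrN ger0_norm ?ler0n //.
  by apply: dependents_powR => //; apply: (loglen_ge_sqr R) => //; near: q.
exists 2; near=> q.
have l_ge : (16 <= loglen q)%N by near: q; exact: near_loglen.
apply: count_indep_close => //; first by near: q.
by apply: (loglen_ge_sqr R) => //; near: q.
Unshelve. all: by end_near. Qed.
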